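(* Let $m\geq 1$, let $i_1,i_2,\ldots,i_m\geq 1$ and $q\geq 2$ be positive integers. For a composition $\xi=(\xi_1,\xi_2,\ldots,\xi_p)\in\mathcal{C}_m$ (where $p$ is the number of parts of $\xi$) and a permutation $\sigma\in\mathcal{S}_m$, denote $$J_c(\xi,\sigma)=i_{\sigma(\xi_1+\cdots+\xi_{c-1}+1)}+\cdots+i_{\sigma(\xi_1+\cdots+\xi_c)},\qquad c=1,2,\ldots,p.$$ Then $$S_{i_1i_2\cdots i_m,q}=\sum_{\xi\in\mathcal{C}_m}\sum_{\sigma\in\mathcal{S}_m}\frac{1}{\xi_1!\,\xi_2!\cdots\xi_p!}\Big\{\zeta\big(q,J_1(\xi,\sigma),J_2(\xi,\sigma),\ldots,J_p(\xi,\sigma)\big)+\zeta\big(q+J_1(\xi,\sigma),J_2(\xi,\sigma),\ldots,J_p(\xi,\sigma)\big)\Big\}.$$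
   Context: Generalized harmonic numbers: $H_n^{(r)}=\sum_{k=1}^n k^{-r}$ for positive integers $n,r$. Euler sum: $S_{i_1i_2\cdots i_m,q}=\sum_{n=1}^{\infty}\frac{H_n^{(i_1)}H_n^{(i_2)}\cdots H_n^{(i_m)}}{n^q}$. Multiple zeta values: for positive integers $s_1,\ldots,s_k$ with $s_1>1$, $\zeta(s_1,s_2,\ldots,s_k)=\sum_{n_1>n_2>\cdots>n_k\geq 1}\frac{1}{n_1^{s_1}n_2^{s_2}\cdots n_k^{s_k}}$. $\mathcal{S}_m$ is the symmetric group of all permutations of $\{1,\ldots,m\}$. A composition of $m$ is an ordered tuple of positive integers whose elements sum to $m$; $\mathcal{C}_m$ is the set of all compositions of $m$. For $c=1$, the empty sum $\xi_1+\cdots+\xi_{c-1}$ is $0$. *)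

(* Defs.v *)
From HB Require Import structures.
From mathcomp Require Import all_boot all_order all_algebra all_fingroup.
From mathcomp Require Import all_classical all_reals all_analysis.

Set Implicit Arguments.
Unset Strict Implicit.
Unset Printing Implicit Defensive.

Import Order.TTheory GRing.Theory Num.Theory.

Local Open Scope classical_set_scope.
Local Open Scope ring_scope.

Definition gharmonic (R : realType) (n r : nat) : R :=
  \sum_(1 <= k < n.+1) k%:R ^- r.

(* Euler sums and multiple zeta values are series of nonnegative terms; they
   are taken in the extended reals, so that the value is +oo exactly when the
   series diverges. *)
Definition euler_sum (R : realType) (m : nat) (i : 'I_m -> nat) (q : nat) :
    \bar R :=
  (\sum_(1 <= n <oo) ((\prod_(j < m) gharmonic R n (i j)) / n%:R ^+ q)%:E)%E.

(* The tuples (n_1, ..., n_k) with n_1 > ... > n_k >= 1. *)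
Definition mzv_index (k : nat) : set (seq nat) :=
  [set n | [/\ size n = k, sorted gtn n & all (leq 1) n]].

Definition mzv (R : realType) (s : seq nat) : \bar R :=
  (\esum_(n in mzv_index (size s))
     (\prod_(c < size s) (nth 0%N n c)%:R ^- nth 0%N s c)%:E)%E.

Definition compositions (m : nat) : set (seq nat) :=
  [set xi | all (leq 1) xi /\ sumn xi = m].

(* Sums over the set of compositions of m use the finitely supported
   [\sum_(_ \in _)], which is 0 by convention on infinite supports; this lemma
   excludes that case. *)
Lemma finite_compositions (m : nat) : finite_set (compositions m).
Proof.
pose f (t : m.-bseq 'I_m.+1) : seq nat := map val (bseqval t).
apply: (@sub_finite_set _ _ (f @` setT)); last first.
  exact/finite_image/finite_finset.
move=> xi [xi_pos xi_sum].
have bnd (s : seq nat) : all (leq 1) s ->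
    (size s <= sumn s)%N /\ all (fun x => x < (sumn s).+1)%N s.
  elim: s => //= x s IHs /andP[x_gt0 /IHs [szs als]]; split.
    by rewrite -add1n leq_add.
  rewrite ltnS leq_addr /=; apply: sub_all als => y /=.
  by rewrite !ltnS => /leq_trans; apply; rewrite leq_addl.
have [szx alx] := bnd _ xi_pos; rewrite xi_sum in szx alx.
have szt : (size (map (@inord m) xi) <= m)%N by rewrite size_map.
exists (Bseq szt) => //; rewrite /f /= -map_comp -[RHS]map_id.
by apply/eq_in_map => x /(allP alx) xm /=; rewrite inordK.
Qed.

(* The parts of xi and the domain of i are numbered from 0: blockJ i xi sigma c
   is J_{c+1}(xi, sigma), and its j are the 0-based positions of the
   (c+1)-st block of consecutive indices. *)
Definition blockJ (m : nat) (i : 'I_m -> nat) (xi : seq nat) (sigma : 'S_m)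
    (c : nat) : nat :=
  (\sum_(j < m | sumn (take c xi) <= j < sumn (take c.+1 xi)) i (sigma j))%N.

(* Main.v *)
(* With [h_s(N)] the sum of [1 / (n_1^s_1 ... n_p^s_p)] over
   [N >= n_1 > ... > n_p >= 1], the right-hand side is a sum over [N] of
   [N^-q] times a finite combination of numbers [h_J(N)], so it suffices to prove
   [\prod_j H_N^(i_j) = \sum_xi \sum_sigma h_J(xi, sigma)(N) / (xi_1! ... xi_p!)].
   This goes by induction on [N]: on the left
   [\prod_j (N^-i_j + H_(N-1)^(i_j))] expands over the set [B] of the indices
   where the first term is chosen; on the right [B] is the set of indices in the
   block carried by [n_1] when [n_1 = N] ([B] is empty when [n_1 < N]), and each
   [B] arises from [#|B|!] orderings. *)
Require Import Defs.
From mathcomp Require Import all_boot all_order all_algebra all_fingroup.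
From mathcomp Require Import all_classical all_reals all_analysis.
From mathcomp Require Import ring lra zify.

Import Order.TTheory GRing.Theory Num.Theory.

Local Open Scope classical_set_scope.
Local Open Scope ring_scope.

(** * Subsets and orderings of a finite set *)

Section SubsetExpansion.
Variables (F : numFieldType) (T : finType).
Implicit Types (A B : {set T}) (x y : T -> F).

Lemma prodrD_subset A x y :
  \prod_(a in A) (x a + y a) =
  \sum_(B : {set T} | B \subset A)
    (\prod_(a in B) x a) * \prod_(a in A :\: B) y a.
Proof.
rewrite big_mkcond /=.
(* Outside [A] the factor is [0 + 1], so the expansion over all subsets of [T] gives the term 0 to
   every [B] that leaves [A]. *)
transitivity (\prod_a ((if a \in A then x a else 0) +
                       (if a \in A then y a else 1))).
  by apply: eq_bigr => a _; case: ifP => // _; rewrite add0r.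
rewrite bigA_distr [RHS]big_mkcond /=; apply: eq_bigr => B _.
case: ifP => [BA|/negbT/subsetPn[a aB aA]]; last first.
  by rewrite (bigD1 a) //= aB (negbTE aA) mul0r.
rewrite (bigID (mem B)) /=; congr (_ * _).
  by apply: eq_bigr => a aB; rewrite aB (fintype.subsetP BA).
rewrite [RHS]big_mkcond [LHS]big_mkcond; apply: eq_bigr => a _.
by rewrite inE /=; case: (a \in B); case: (a \in A).
Qed.

Lemma big_permutations_recl A (f : seq T -> F) : A != finset.set0 ->
  \sum_(t <- permutations (enum A)) f t =
  \sum_(a in A) \sum_(t <- permutations (enum (A :\ a))) f (a :: t).
Proof.
move=> A0; have sA : (0 < size (enum A))%N by rewrite -cardE card_gt0.
rewrite (perm_big _ (permutationsE sA)) /= big_allpairs_dep.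
rewrite undup_id ?enum_uniq// big_enum /=; apply: eq_bigr => a aA.
apply/perm_big/perm_permutations/uniq_perm; rewrite ?rem_uniq ?enum_uniq//.
by move=> b; rewrite mem_rem_uniq ?enum_uniq// !inE !mem_enum !inE.
Qed.

(* Each set [B] is the set of entries of [take k t] for [k`!] orderings of it,
   which the factor [k`!%:R^-1] cancels. *)
Lemma sum_permutations_split k A x (f : seq T -> F) : (k <= #|A|)%N ->
  \sum_(t <- permutations (enum A))
    k`!%:R^-1 * (\prod_(a <- take k t) x a) * f (drop k t) =
  \sum_(B : {set T} | (B \subset A) && (#|B| == k))
    (\prod_(a in B) x a) * \sum_(t <- permutations (enum (A :\: B))) f t.
Proof.
elim: k A => [|k IHk] A kA.
  rewrite (big_pred1 finset.set0) => [|B].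
    rewrite big_set0 mul1r finset.setD0; apply: eq_bigr => t _.
    by rewrite take0 big_nil drop0 fact0 invr1 !mul1r.
  by rewrite cards_eq0 andbC /=; case: eqP => //= ->; rewrite finset.sub0set.
pose G B := (\prod_(a in B) x a) * \sum_(t <- permutations (enum (A :\: B))) f t.
(* With the head [a] fixed, the induction hypothesis on [A :\ a] ranges over the sets [B :\ a]. Each
   [B] is reached once from each of its [k.+1] elements, which cancels [k.+1%:R^-1]. *)
have step a : a \in A ->
    \sum_(t <- permutations (enum (A :\ a)))
      (k.+1)`!%:R^-1 * (\prod_(b <- take k.+1 (a :: t)) x b) *
        f (drop k.+1 (a :: t)) =
    \sum_(B : {set T} | [&& B \subset A, #|B| == k.+1 & a \in B])
      k.+1%:R^-1 * G B.
  move=> aA; transitivity (k.+1%:R^-1 * x a *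
      \sum_(t <- permutations (enum (A :\ a)))
         k`!%:R^-1 * (\prod_(b <- take k t) x b) * f (drop k t)).
    rewrite mulr_sumr; apply: eq_bigr => t _.
    by rewrite /= big_cons factS natrM invfM; ring.
  rewrite IHk; last by move: kA; rewrite (cardsD1 a) aA.
  rewrite mulr_sumr (reindex_onto (fun B => B :\ a) (fun B => a |: B)) /=;
    last first.
    move=> B /andP[BA _]; rewrite finset.setU1K//.
    by apply/negP => /(fintype.subsetP BA); rewrite !inE eqxx.
  apply: eq_big => B.
    have [aB|aB] := boolP (a \in B).
      have BA : (B \subset A) = (B :\ a \subset A).
        by rewrite -{1}(finset.setD1K aB) finset.subUset finset.sub1set aA.
      rewrite finset.setD1K// eqxx !andbT BA (cardsD1 a B) aB add1n eqSS.
      by rewrite finset.subsetD1 !inE eqxx andbT.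
    rewrite !andbF; apply/negbTE; rewrite negb_and orbC; apply/orP; left.
    by apply: contra aB => /eqP <-; rewrite !inE eqxx.
  move=> /andP[_ /eqP aB]; have {}aB : a \in B by rewrite -aB !inE eqxx.
  rewrite /G (big_setD1 a aB) /= (_ : A :\ a :\: (B :\ a) = A :\: B);
    first by ring.
  by apply/setP => b; rewrite !inE; case: eqP => // ->; rewrite aB.
rewrite big_permutations_recl; last by rewrite -card_gt0 (leq_trans _ kA).
rewrite (eq_bigr _ step) (exchange_big_dep (fun B : {set T} =>
  (B \subset A) && (#|B| == k.+1))) /=; last by move=> a B _ /and3P[-> ->].
apply: eq_bigr => B /andP[BA /eqP cB].
rewrite (eq_bigl (mem B)) => [|a].
  by rewrite sumr_const cB -[LHS]mulr_natl mulrA divff ?mul1r ?pnatr_eq0.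
by rewrite BA cB eqxx /=; case: (boolP (a \in B)) => [/(fintype.subsetP BA) ->|];
  rewrite ?andbF.
Qed.

(** Summing over the cut position [k] frees the cardinality of [B]. *)
Lemma sum_permutations_subset A x (f : seq T -> F) :
  \sum_(t <- permutations (enum A)) \sum_(k < (size t).+1)
    k`!%:R^-1 * (\prod_(a <- take k t) x a) * f (drop k t) =
  \sum_(B : {set T} | B \subset A)
    (\prod_(a in B) x a) * \sum_(t <- permutations (enum (A :\: B))) f t.
Proof.
transitivity (\sum_(k < #|A|.+1) \sum_(t <- permutations (enum A))
    k`!%:R^-1 * (\prod_(a <- take k t) x a) * f (drop k t)).
  rewrite exchange_big /=; apply: eq_big_seq => t.
  by rewrite mem_permutations => /perm_size ->; rewrite -cardE.
rewrite (partition_big (fun B : {set T} => inord #|B| : 'I_#|A|.+1) xpredT) //=.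
apply: eq_bigr => k _; rewrite sum_permutations_split; last by rewrite -ltnS.
apply: eq_bigl => B; case: (boolP (B \subset A)) => //= BA.
by rewrite -val_eqE /= inordK// ltnS subset_leq_card.
Qed.

End SubsetExpansion.

(** * Compositions, enumerated by their first part *)

Definition comps (m : nat) : seq (seq nat) :=
  finmap.enum_fset (fset_set (compositions m)).

Lemma mem_comps m xi : (xi \in comps m) = all (leq 1) xi && (sumn xi == m).
Proof.
rewrite [LHS]in_fset_set; last exact: finite_compositions.
by apply/idP/andP; rewrite inE => -[? /eqP].
Qed.

Lemma comps0 : comps 0 = [:: [::]].
Proof.
apply: perm_small_eq => //; apply: uniq_perm; rewrite ?finmap.fset_uniq// => xi.
by rewrite mem_comps inE; case: xi => [|[|x] xi] //=; rewrite addSn andbF.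
Qed.

Lemma comps_recl m :
  perm_eq (comps m.+1) [seq k.+1 :: xi | k <- iota 0 m.+1, xi <- comps (m - k)].
Proof.
apply: uniq_perm; first exact: finmap.fset_uniq.
  apply: allpairs_uniq_dep; rewrite ?iota_uniq//.
  - by move=> k _; exact: finmap.fset_uniq.
  - by move=> [k xi] [l eta] _ _ /= [-> ->].
move=> xi; rewrite mem_comps; apply/andP/allpairsPdep => [[]|].
  case: xi => [//|[//|k] xi] /= xi1 /eqP[kxi]; exists k, xi; split=> //.
    by rewrite -/(iota 0 m.+1) mem_iota add0n ltnS -kxi leq_addr.
  by rewrite mem_comps xi1 -kxi addKn eqxx.
move=> [k [eta [+ + ->]]]; rewrite mem_iota mem_comps add0n /= => km.
by move=> /andP[-> /eqP ->]; rewrite addSn subnKC.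
Qed.

Lemma big_comps_recl (V : nmodType) m (f : seq nat -> V) :
  \sum_(xi <- comps m.+1) f xi =
  \sum_(k < m.+1) \sum_(xi <- comps (m - k)) f (k.+1 :: xi).
Proof.
rewrite -(big_mkord xpredT (fun k => \sum_(xi <- comps (m - k)) f (k.+1 :: xi))).
by rewrite (perm_big _ (comps_recl m)) big_allpairs_dep /index_iota subn0.
Qed.

(** * Products of harmonic numbers as combinations of multiple harmonic sums *)

Section HarmonicProduct.
Variable R : realType.

(** The number [h_s(N)]. The index [n] stands for [n_1 - 1], so the inner bound [n] expresses
    [n_2 < n_1]. *)
Fixpoint mhs (s : seq nat) (N : nat) : R :=
  if s is a :: s' then \sum_(n < N) n.+1%:R ^- a * mhs s' n else 1.

Lemma mhs_ge0 s N : 0 <= mhs s N.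
Proof.
elim: s N => //= a s IHs N; apply: sumr_ge0 => n _.
by rewrite mulr_ge0// invr_ge0 exprn_ge0.
Qed.

Lemma mhsS a s N : mhs (a :: s) N.+1 = mhs (a :: s) N + N.+1%:R ^- a * mhs s N.
Proof. by rewrite /= big_ord_recr. Qed.

(** The contribution of a single ordering [v] of the exponents: [reshape xi v] cuts [v] into the
    blocks whose sums are the [J_c]. *)
Definition comps_mhs (N : nat) (v : seq nat) : R :=
  \sum_(xi <- comps (size v))
    (\prod_(x <- xi) x`!%:R^-1) * mhs (map sumn (reshape xi v)) N.

Lemma comps_mhs_nil N : comps_mhs N [::] = 1.
Proof. by rewrite /comps_mhs comps0 big_seq1 big_nil mul1r. Qed.

Lemma comps_mhs0 a v : comps_mhs 0 (a :: v) = 0.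
Proof.
rewrite /comps_mhs big_comps_recl big1// => k _; rewrite big1// => xi _.
by rewrite /= big_ord0 mulr0.
Qed.

(** Here [k] is the length of the block carried by [n_1 = N.+1], and [k = 0] accounts for
    [n_1 <= N]. *)
Lemma comps_mhsS N v :
  comps_mhs N.+1 v =
  \sum_(k < (size v).+1)
    k`!%:R^-1 * N.+1%:R ^- sumn (take k v) * comps_mhs N (drop k v).
Proof.
rewrite big_ord_recl take0 drop0 /= expr0 fact0 !invr1 !mul1r.
case: v => [|a v]; first by rewrite big_ord0 addr0 !comps_mhs_nil.
rewrite /comps_mhs /= !big_comps_recl -big_split /=; apply: eq_bigr => k _.
rewrite size_drop mulr_sumr -big_split /=; apply: eq_bigr => xi _.
rewrite big_cons /= big_ord_recr /=; ring.
Qed.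

Lemma gharmonicS N r : gharmonic R N.+1 r = N.+1%:R ^- r + gharmonic R N r.
Proof. by rewrite /gharmonic big_nat_recr//= addrC. Qed.

(** Both sides obey the same recursion in [N]. It passes from [A] to the sets [A :\: B], so [A] has
    to vary in the induction. *)
Lemma sum_permutations_comps_mhs (T : finType) (i : T -> nat) N (A : {set T}) :
  \sum_(t <- permutations (enum A)) comps_mhs N (map i t) =
  \prod_(a in A) gharmonic R N (i a).
Proof.
elim: N A => [|N IHN] A.
  (* At [N = 0] both sides are 1 if [A] is empty and 0 otherwise. *)
  have [->|A0] := eqVneq A finset.set0.
    by rewrite finset.big_set0 enum_set0 big_seq1 comps_mhs_nil.
  rewrite big_permutations_recl// big1 => [|a _]; last first.
    by rewrite big1// => t _; exact: comps_mhs0.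
  have [a aA] := set0Pn _ A0.
  by rewrite (big_setD1 a aA) /= /gharmonic big_geq// mul0r.
under [RHS]eq_bigr => a _ do rewrite gharmonicS.
rewrite prodrD_subset; under [RHS]eq_bigr => B _ do rewrite -IHN.
rewrite -sum_permutations_subset; apply: eq_bigr => t _.
rewrite comps_mhsS size_map; apply: eq_bigr => k _; rewrite -map_take -map_drop.
congr (_ * _ * _); elim: (take k t) => [|a s IHs] /=.
  by rewrite big_nil expr0 invr1.
by rewrite big_cons exprD invfM IHs.
Qed.

(** Sending [sigma] to its list of values is injective, and there are [m!] objects on each side, so
    it is a bijection. *)
Lemma sum_perm_permutations (m : nat) (f : seq 'I_m -> R) :
  \sum_(sigma : 'S_m) f (map sigma (enum 'I_m)) =
  \sum_(t <- permutations (enum 'I_m)) f t.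
Proof.
pose e (sigma : 'S_m) := map sigma (enum 'I_m).
have e_inj : injective e.
  by move=> s1 s2 /eq_in_map e12; apply/permP => j; rewrite e12 ?mem_enum.
have ue : uniq (map e (enum 'S_m)) by rewrite map_inj_uniq ?enum_uniq.
transitivity (\sum_(t <- map e (enum 'S_m)) f t);
  first by rewrite big_map big_enum.
apply: perm_big.
have [||_ mem_e] :=
  @uniq_min_size _ (map e (enum 'S_m)) (permutations (enum 'I_m)) ue.
- move=> _ /mapP[s _ ->]; rewrite mem_permutations; apply: uniq_perm.
  + by rewrite map_inj_uniq ?enum_uniq//; exact: perm_inj.
  + exact: enum_uniq.
  + move=> j; rewrite mem_enum; apply/mapP; exists (s^-1 j)%g.
      by rewrite mem_enum.
    by rewrite permKV.
- by rewrite size_permutations ?enum_uniq// (size_map e) -!cardE card_Sn card_ord.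
- by apply: uniq_perm => //; exact: permutations_uniq.
Qed.

End HarmonicProduct.

(** * Block sums of a permuted family *)

Lemma sumn_take_ord (m b : nat) (f : 'I_m -> nat) : (b <= m)%N ->
  sumn (take b (map f (enum 'I_m))) = (\sum_(j < m | j < b) f j)%N.
Proof.
move=> bm; rewrite -map_take sumnE big_map.
transitivity (\sum_(j <- [seq j <- enum 'I_m | (val j < b)%N]) f j)%N;
  last by rewrite big_filter big_enum_cond.
congr (\sum_(j <- _) _)%N; apply: (inj_map val_inj).
rewrite map_take val_enum_ord take_iota (minn_idPl bm).
transitivity [seq x <- map val (enum 'I_m) | (x < b)%N]; last exact: filter_map.
by rewrite val_enum_ord -[b in RHS]add0n filter_iota_ltn.
Qed.

Lemma map_blockJ (m : nat) (i : 'I_m -> nat) (xi : seq nat) (sigma : 'S_m) :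
  sumn xi = m ->
  [seq blockJ i xi sigma c | c <- iota 0 (size xi)] =
  map sumn (reshape xi (map i (map sigma (enum 'I_m)))).
Proof.
move=> xim.
have sxi : size (reshape xi (map i (map sigma (enum 'I_m)))) = size xi.
  by rewrite size_reshape.
apply: (@eq_from_nth _ 0%N); first by rewrite !size_map size_iota sxi.
move=> c; rewrite size_map size_iota => cxi.
rewrite (nth_map 0%N) ?size_iota// (nth_map [::]) ?sxi// nth_iota// add0n.
rewrite nth_reshape /blockJ -map_comp.
set a := sumn (take c xi); set v := map _ _.
have -> : sumn (take c.+1 xi) = (a + nth 0%N xi c)%N.
  by rewrite (take_nth 0%N)// sumn_rcons.
have abm : (a + nth 0%N xi c <= m)%N.
  rewrite -xim -{2}(cat_take_drop c.+1 xi) sumn_cat (take_nth 0%N)// sumn_rcons.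
  exact: leq_addr.
have am : (a <= m)%N by apply: leq_trans abm; exact: leq_addr.
(* Adding the entries before the block turns the block sum into a prefix sum, to which
   [sumn_take_ord] applies. *)
apply: (@addnI (sumn (take a v))); rewrite -sumn_cat -takeD !sumn_take_ord//.
rewrite [RHS](bigID (fun j : 'I_m => (j < a)%N)) /=; congr (_ + _)%N.
  by apply: eq_bigl => j; lia.
by apply: eq_bigl => j; lia.
Qed.

(** * Multiple zeta values as series over the largest index *)

Section MultipleZetaValue.
Variable R : realType.

Let term (s t : seq nat) : R :=
  \prod_(c < size s) (nth 0%N t c)%:R ^- nth 0%N s c.

Let term_ge0 s t : 0 <= term s t.
Proof. by apply: prodr_ge0 => c _; rewrite invr_ge0 exprn_ge0. Qed.

Let bounded_index (k N : nat) : set (seq nat) :=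
  mzv_index k `&` [set t | all (leq^~ N) t].

Let gtn_trans : transitive gtn.
Proof. by move=> x y z yx xz; exact: ltn_trans yx. Qed.

(** The condition [P] on [n_1 - 1] serves both the full sum ([setT]) and the sum truncated at [N]
    ([I_N]); [c] collects the factors already split off. *)
Lemma esum_mzv_cons (P : set nat) (c : R) a s : 0 <= c ->
  (\esum_(t in [set t | mzv_index (size s).+1 t /\ P (head 0%N t).-1])
     (c * term (a :: s) t)%:E =
   \esum_(n in P) \esum_(t in bounded_index (size s) n)
     (c * n.+1%:R ^- a * term s t)%:E)%E.
Proof.
move=> c0; rewrite esum_esum => [|n t _ _]; last first.
  by rewrite lee_fin !mulr_ge0 ?invr_ge0 ?exprn_ge0.
(* Entries are positive, so [n_1 = n.+1]; the remaining entries are below [n_1], that is, at most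
   [n]. *)
pose e (nt : nat * seq nat) := nt.1.+1 :: nt.2.
have -> : [set t | mzv_index (size s).+1 t /\ P (head 0%N t).-1] =
    e @` (P `*`` (fun n => bounded_index (size s) n)).
  apply/seteqP; split => [t [[]]|_ [[n t] /= [Pn [[st t_sorted t1] tn]] <-]].
    case: t => // -[//|n] t /= [st].
    rewrite (path_sortedE gtn_trans).
    by move=> /andP[tn t_sorted] t1 Pn; exists (n, t).
  split=> //; split=> /=; [by rewrite st| |exact: t1].
  rewrite (path_sortedE gtn_trans).
  by rewrite t_sorted andbT.
rewrite esum_image => [|[n t] [m u] _ _ [-> ->]//].
apply: eq_esum => -[n t] _ /=; congr EFin.
by rewrite /term /= big_ord_recl /= mulrA.
Qed.

Lemma esum_bounded_index (c : R) s N : 0 <= c ->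
  (\esum_(t in bounded_index (size s) N) (c * term s t)%:E =
   (c * mhs R s N)%:E)%E.
Proof.
elim: s c N => [|a s IHs] c N c0.
  rewrite (_ : bounded_index _ _ = [set [::]]) ?esum_set1 ?lee_fin ?mulr_ge0//.
    by rewrite /term big_ord0.
  by apply/seteqP; split => [[|x t] [[]]|_ ->].
(* The entries decrease, so bounding all of them by [N] amounts to bounding the head. *)
have -> : bounded_index (size (a :: s)) N =
    [set t | mzv_index (size s).+1 t /\ `I_N (head 0%N t).-1].
  apply/seteqP; split => [] [|[|n] t] [] [] //= st t_sorted t1.
    by move=> /andP[].
  move=> nN; split=> //=; rewrite nN /=.
  move: t_sorted; rewrite (path_sortedE gtn_trans).
  by move=> /andP[+ _]; apply: sub_all => x /= xn; apply: leq_trans nN;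
    exact: ltnW.
rewrite esum_mzv_cons//.
transitivity (\esum_(n in `I_N) (c * n.+1%:R ^- a * mhs R s n)%:E)%E.
  by apply: eq_esum => n _; rewrite IHs// mulr_ge0 ?invr_ge0 ?exprn_ge0.
rewrite esum_fset//; last first.
  by move=> n _; rewrite lee_fin !mulr_ge0 ?invr_ge0 ?exprn_ge0 ?mhs_ge0.
rewrite -fsbig_ord sumEFin mulr_sumr; congr EFin.
by apply: eq_bigr => n _; rewrite mulrA.
Qed.

Lemma mzv_cons a s :
  (mzv R (a :: s) = \sum_(0 <= n <oo) (n.+1%:R ^- a * mhs R s n)%:E)%E.
Proof.
rewrite nneseries_esumT; last first.
  by move=> n; rewrite lee_fin mulr_ge0 ?invr_ge0 ?exprn_ge0 ?mhs_ge0.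
have idx : mzv_index (size s).+1 =
    [set t | mzv_index (size s).+1 t /\ setT (head 0%N t).-1].
  by apply/seteqP; split => t // [].
transitivity (\esum_(t in [set t | mzv_index (size s).+1 t /\
                                  setT (head 0%N t).-1])
    (1 * term (a :: s) t)%:E)%E.
  by rewrite -idx; apply: eq_esum => t _; rewrite mul1r.
rewrite esum_mzv_cons//; apply: eq_esum => n _.
by rewrite esum_bounded_index ?mul1r// invr_ge0 exprn_ge0.
Qed.

(* The two zeta values are the parts [n_1 < N] and [n_1 = N] of a sum over
   [N >= n_1 > n_2 > ...]. *)
Lemma mzv_consD q a s :
  (mzv R [:: q, a & s] + mzv R ((q + a)%N :: s) =
   \sum_(0 <= n <oo) (n.+1%:R ^- q * mhs R (a :: s) n.+1)%:E)%E.
Proof.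
rewrite !mzv_cons -nneseriesD; last first.
- by move=> n _ _; rewrite lee_fin mulr_ge0 ?invr_ge0 ?exprn_ge0 ?mhs_ge0.
- by move=> n _ _; rewrite lee_fin mulr_ge0 ?invr_ge0 ?exprn_ge0 ?mhs_ge0.
apply: eq_eseriesr => n _; rewrite -EFinD mhsS exprD invfM mulrDr.
by rewrite !mulrA.
Qed.

End MultipleZetaValue.

(** * Convergence of the Euler sums *)

Section EulerSumFinite.
Variable R : realType.
Local Notation H n := (gharmonic R n 1).

Lemma gharmonic_ge0 n r : 0 <= gharmonic R n r.
Proof. by apply: sumr_ge0 => k _; rewrite invr_ge0 exprn_ge0. Qed.

Lemma gharmonic_le n r : (1 <= r)%N -> gharmonic R n r <= H n.
Proof.
move=> r1; rewrite /gharmonic big_nat_cond [leRHS]big_nat_cond.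
apply: ler_sum => k /andP[/andP[k1 _] _].
by rewrite lef_pV2 ?posrE ?exprn_gt0 ?ltr0n// ler_weXn2l// ler1n.
Qed.

(** The mean value estimate for the power [k.+1] on the interval from [y] to [x]. *)
Lemma subrX_le (x y : R) k : 0 <= y -> y <= x ->
  x ^+ k.+1 - y ^+ k.+1 <= k.+1%:R * x ^+ k * (x - y).
Proof.
move=> y0 yx; have x0 := le_trans y0 yx.
elim: k => [|k IHk]; first by rewrite expr0 !expr1 !mul1r.
have yxk : y ^+ k.+1 <= x ^+ k.+1 by rewrite lerXn2r ?nnegrE.
rewrite exprS (exprS y) -natr1.
have -> : x * x ^+ k.+1 - y * y ^+ k.+1 =
  x * (x ^+ k.+1 - y ^+ k.+1) + y ^+ k.+1 * (x - y) by ring.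
have -> : (k.+1%:R + 1) * x ^+ k.+1 * (x - y) =
  x * (k.+1%:R * x ^+ k * (x - y)) + x ^+ k.+1 * (x - y).
  by rewrite exprS; ring.
by apply: lerD; [exact: ler_wpM2l|apply: ler_wpM2r => //; rewrite subr_ge0].
Qed.

Let hsum k N : R := \sum_(n < N) H n.+1 ^+ k / n.+1%:R ^+ 2.

(* Summation by parts, with [1 / n ^ 2 <= 2 (1 / n - 1 / (n + 1))]. *)
Lemma sum_harmonicX_le k N :
  hsum k.+1 N + 2 * H N ^+ k.+1 / N.+1%:R <= 2 * k.+1%:R * hsum k N.
Proof.
rewrite /hsum; elim: N => [|N IHN].
  by rewrite !big_ord0 /gharmonic big_geq// expr0n/= !mulr0 mul0r addr0.
rewrite !big_ord_recr /= mulrDr.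
set x := H N.+1; set y := H N; set u : R := N.+1%:R^-1; set v : R := N.+2%:R^-1.
have y0 : 0 <= y := gharmonic_ge0 N 1.
have u0 : 0 < u by rewrite invr_gt0 ltr0n.
have xyu : x - y = u by rewrite /x gharmonicS expr1 addrK.
have yx : y <= x by rewrite -subr_ge0 xyu ltW.
(* Together with [u - v = u * v] this gives [u ^ 2 <= 2 * (u - v)]. *)
have uv : u <= 2 * v.
  rewrite -[2]invrK -invfM lef_pV2 ?posrE ?mulr_gt0 ?invr_gt0 ?ltr0n//.
  by rewrite mulrC ler_pdivrMr// -natrM ler_nat; lia.
have uvE : u - v = u * v.
  have : (N.+1%:R : R) != 0 by rewrite pnatr_eq0.
  have : (N.+2%:R : R) != 0 by rewrite pnatr_eq0.
  by rewrite /u /v -(natr1 N.+1) => ? ?; field; apply/andP.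
have X0 : 0 <= x ^+ k.+1 by rewrite exprn_ge0// (le_trans y0).
have := @subrX_le x y k y0 yx; rewrite xyu => bern.
have {}bern : 2 * u * (x ^+ k.+1 - y ^+ k.+1) <= 2 * u * (k.+1%:R * x ^+ k * u).
  by rewrite ler_wpM2l// mulr_ge0// ltW.
have uXuv : 0 <= u * x ^+ k.+1 * (2 * v - u).
  by rewrite !mulr_ge0 ?(ltW u0)// subr_ge0.
have vE : 2 * x ^+ k.+1 * v = 2 * x ^+ k.+1 * (u - u * v) by rewrite -uvE; ring.
(* Once [vE] has rewritten the boundary term, the goal is the sum of [IHN], [bern] and [uXuv]. *)
rewrite -/u -/y in IHN; rewrite -exprVn -/u vE; nra.
Qed.

Lemma sum_harmonicX_bounded k : exists C, forall N, hsum k N <= C.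
Proof.
elim: k => [|k [C hC]]; last first.
  exists (2 * k.+1%:R * C) => N.
  apply: le_trans (le_trans (sum_harmonicX_le k N) _); last by rewrite ler_wpM2l.
  by rewrite lerDl divr_ge0// mulr_ge0// exprn_ge0// gharmonic_ge0.
(* The extra term makes the bound inductive: the step is [1 / M ^ 2 <= 2 / M - 2 / (M + 1)] for
   [M >= 1]. *)
exists 2 => N; suff : hsum 0 N + 2 / N.+1%:R <= 2.
  by apply: le_trans; rewrite lerDl divr_ge0.
rewrite /hsum; elim: N => [|N IHN]; first by rewrite big_ord0 add0r divr1.
apply: le_trans IHN; rewrite big_ord_recr /= expr0 -addrA lerD2l.
rewrite -(natr1 N.+1); set M : R := N.+1%:R.
have M1 : 1 <= M by rewrite ler1n.
rewrite -subr_ge0 (_ : _ - _ = (M - 1) / (M ^+ 2 * (M + 1))); last by field; lra.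
by rewrite divr_ge0 ?subr_ge0// mulr_ge0 ?exprn_ge0//; lra.
Qed.

(** The worst case is that of all [i j = 1] and [q = 2], whose partial sums are the bounded
    [hsum m N]. *)
Lemma euler_sum_fin_num m (i : 'I_m -> nat) q :
  (forall j, (1 <= i j)%N) -> (2 <= q)%N ->
  euler_sum R i q \is a fin_num.
Proof.
move=> i1 q2; have [C hC] := sum_harmonicX_bounded m.
pose f n := ((\prod_(j < m) gharmonic R n (i j)) / n%:R ^+ q)%:E.
have f0 n : (0 <= f n)%E.
  rewrite lee_fin divr_ge0 ?exprn_ge0// prodr_ge0// => j _.
  exact: gharmonic_ge0.
rewrite /euler_sum -(nneseries_addn 1 f0) ge0_fin_numE; last first.
  by apply: nneseries_ge0 => n _ _; exact: f0.
apply: (@le_lt_trans _ _ C%:E); last exact: ltry.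
apply: lime_le; first by apply: is_cvg_nneseries => n _ _; exact: f0.
apply: nearW => N; rewrite sumEFin lee_fin; apply: le_trans (hC N).
rewrite big_mkord; apply: ler_sum => n _; rewrite addn1; apply: ler_pM.
- by rewrite prodr_ge0// => j _; exact: gharmonic_ge0.
- by rewrite invr_ge0 exprn_ge0.
- rewrite -[X in _ ^+ X]card_ord -prodr_const; apply: ler_prod => j _.
  by rewrite gharmonic_ge0 gharmonic_le.
- by rewrite lef_pV2 ?posrE ?exprn_gt0 ?ltr0n// ler_weXn2l// ler1n.
Qed.

End EulerSumFinite.

(** * Summation of the product formula over [N] *)

Theorem theorem2p1 (R : realType) (m : nat) (i : 'I_m -> nat) (q : nat)
    (m_ge1 : (1 <= m)%N) (i_ge1 : forall j, (1 <= i j)%N) (q_ge2 : (2 <= q)%N) :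
  euler_sum R i q \is a fin_num /\
  euler_sum R i q =
    (\sum_(xi \in compositions m) \sum_(sigma : 'S_m)
       (\prod_(x <- xi) (x`!)%:R^-1)%:E *
       (mzv R (q :: [seq blockJ i xi sigma c | c <- iota 0 (size xi)]) +
        mzv R ((q + blockJ i xi sigma 0)%N ::
               [seq blockJ i xi sigma c | c <- iota 1 (size xi).-1])))%E.
Proof.
split; first exact: euler_sum_fin_num.
rewrite fsbig_finite; last exact: finite_compositions.
pose v (sigma : 'S_m) := map i (map sigma (enum 'I_m)).
pose w xi : R := \prod_(x <- xi) x`!%:R^-1.
have w0 xi : 0 <= w xi by rewrite prodr_ge0.
(* The part of the term [N = n.+1] that belongs to [xi] and [sigma]. *)
pose g xi (sigma : 'S_m) n : R :=
  w xi * (n.+1%:R ^- q * mhs R (map sumn (reshape xi (v sigma))) n.+1).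
have g0 xi sigma n : 0 <= g xi sigma n.
  by rewrite !mulr_ge0 ?invr_ge0 ?exprn_ge0 ?mhs_ge0.
transitivity (\sum_(xi <- comps m) \sum_(sigma : 'S_m)
    \sum_(0 <= n <oo) (g xi sigma n)%:E)%E; last first.
  apply: eq_big_seq => xi; rewrite -/(comps m) mem_comps => /andP[xi1 /eqP xim].
  apply: eq_bigr => sigma _; have := @map_blockJ m i xi sigma xim.
  (* As [m >= 1], [xi] has a first part, and [mzv_consD] merges the two zeta values. *)
  case: xi xi1 xim => [_ m0|x xi _ _ J]; first by rewrite -m0 in m_ge1.
  rewrite /= mzv_consD [_ :: map _ _]J -nneseriesZl => [//|n _].
  by rewrite lee_fin mulr_ge0 ?invr_ge0 ?exprn_ge0 ?mhs_ge0.
(* The terms are nonnegative, so the finite sums commute with the series. *)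
transitivity (\sum_(0 <= n <oo) \sum_(xi <- comps m) \sum_(sigma : 'S_m)
    (g xi sigma n)%:E)%E; last first.
  rewrite nneseries_sum => [|xi n _]; last first.
    by apply: sume_ge0 => sigma _; rewrite lee_fin.
  by apply: eq_bigr => xi _; rewrite nneseries_sum// => sigma n _; rewrite lee_fin.
rewrite /euler_sum -(nneseries_addn 1) => [|n]; last first.
  rewrite lee_fin divr_ge0 ?exprn_ge0// prodr_ge0// => j _.
  exact: gharmonic_ge0.
apply: eq_eseriesr => n _; rewrite addn1.
under [RHS]eq_bigr => xi _ do rewrite sumEFin.
rewrite sumEFin; congr EFin; rewrite mulrC exchange_big /=.
(* The product formula for the full index set, with its orderings read as permutations. *)
have -> : \prod_(j < m) gharmonic R n.+1 (i j) =
    \sum_(sigma : 'S_m) comps_mhs R n.+1 (v sigma).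
  rewrite (@sum_perm_permutations R m (fun t => comps_mhs R n.+1 (map i t))).
  have <- : enum [set: 'I_m]%SET = enum 'I_m by apply: eq_enum => j; rewrite !inE.
  by rewrite sum_permutations_comps_mhs; apply: eq_bigl => j; rewrite inE.
rewrite mulr_sumr; apply: eq_bigr => sigma _.
rewrite /comps_mhs (size_map i) (size_map sigma) size_enum_ord mulr_sumr.
by apply: eq_bigr => xi _; rewrite mulrCA.
Qed.
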